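(* Let $S:\mathbb{R}^d\to\mathbb{R}$ and let $x_t$ be a boundary point, $S(x_t)=0$, with $\nabla S(x_t)\neq 0$. Suppose $S$ is differentiable with $L$-Lipschitz gradient on a neighborhood of $x_t$ containing the closed ball of radius $\delta$ around $x_t$, where $\delta\in(0,1)$. Let $u_1,\dots,u_B$ be i.i.d. uniform on the unit sphere of $\mathbb{R}^d$, let $\phi(x)=\operatorname{sign}(S(x))$ (equal to $1$ if $S(x)>0$ and $-1$ otherwise), and define $$\widetilde{\nabla S}(x_t,\delta)=\frac1B\sum_{b=1}^B\phi(x_t+\delta u_b)\,u_b.$$ Then $$\cos\angle\big(\mathbb{E}[\widetilde{\nabla S}(x_t,\delta)],\nabla S(x_t)\big)\ \ge\ 1-\frac{9L^2\delta^2 d^2}{8\|\nabla S(x_t)\|_2^2}.$$ In particular, $$\lim_{\delta\to0}\cos\angle\big(\mathbb{E}[\widetilde{\nabla S}(x_t,\delta)],\nabla S(x_t)\big)=1.$$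
   Context: $\cos\angle(a,b)=\langle a,b\rangle/(\|a\|_2\|b\|_2)$ denotes the cosine of the angle between nonzero vectors $a,b\in\mathbb{R}^d$. *)

(* Defs.v *)
From HB Require Import structures.
From mathcomp Require Import all_boot all_order all_algebra.
From mathcomp Require Import all_classical all_reals all_analysis.
Set Implicit Arguments. Unset Strict Implicit. Unset Printing Implicit Defensive.
Import Order.TTheory GRing.Theory Num.Theory.
Import numFieldNormedType.Exports.
Local Open Scope classical_set_scope.
Local Open Scope ring_scope.

(* Borel (product) sigma-algebra on row vectors 'rV[R]_n = R^n:
   generated by the coordinate projections (same construction as the
   library's instance on n.-tuple). *)
Definition rV_measure_display : measure_display -> measure_display.
Proof. exact. Qed.

Section measurable_rV.
Context {d} {T : sigmaRingType d}.
Variable n : nat.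
Let coors : 'I_n -> 'rV[T]_n -> T := fun i x => x ord0 i.
Let rV_set0 : g_sigma_preimage coors set0.
Proof. exact: sigma_algebra0. Qed.
Let rV_setC A : g_sigma_preimage coors A -> g_sigma_preimage coors (~` A).
Proof. exact: sigma_algebraC. Qed.
Let rV_bigcup (F : _^nat) : (forall i, g_sigma_preimage coors (F i)) ->
  g_sigma_preimage coors (\bigcup_i (F i)).
Proof. exact: sigma_algebra_bigcup. Qed.
HB.instance Definition _ := @isMeasurable.Build (rV_measure_display d)
  'rV[T]_n (g_sigma_preimage coors) rV_set0 rV_setC rV_bigcup.
End measurable_rV.

Section defs.
Context {R : realType} {n : nat}.

Definition dotv (a b : 'rV[R]_n) : R := \sum_(i < n) a ord0 i * b ord0 i.
Definition norm2 (a : 'rV[R]_n) : R := Num.sqrt (dotv a a).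

(* cos of the angle between a and b (division by 0 yields 0 in MathComp) *)
Definition cos_angle (a b : 'rV[R]_n) : R := dotv a b / (norm2 a * norm2 b).

Definition unit_sphere : set 'rV[R]_n := [set x | norm2 x = 1].

Definition orthogonal_mx (Q : 'M[R]_n) : Prop := Q *m Q^T = 1%:M.

Definition grad (S : 'rV[R]_n -> R) (x : 'rV[R]_n) : 'rV[R]_n :=
  \row_(i < n) ('d S x : 'rV[R]_n -> R) (delta_mx ord0 i).

Definition sgnS (S : 'rV[R]_n -> R) (x : 'rV[R]_n) : R :=
  if 0 < S x then 1 else -1.

(* A random vector U on (Omega, P) is uniformly distributed on the unit
   sphere: U is measurable, its law is carried by the unit sphere, and its
   law is invariant under every orthogonal transformation (the uniform
   distribution on S^{n-1} is the O(n)-invariant probability on S^{n-1}). *)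
Definition uniform_on_sphere {dO} {Omega : measurableType dO}
    (P : probability Omega R) (U : Omega -> 'rV[R]_n) : Prop :=
  [/\ measurable_fun setT U,
      P (U @^-1` unit_sphere) = 1%E &
      forall Q : 'M[R]_n, orthogonal_mx Q ->
      forall A : set 'rV[R]_n, measurable A ->
        P (U @^-1` ((fun x => x *m Q) @^-1` A)) = P (U @^-1` A)].

Definition mutually_independent {dO} {Omega : measurableType dO}
    (P : probability Omega R) (B : nat) (U : 'I_B -> Omega -> 'rV[R]_n) : Prop :=
  forall A : 'I_B -> set 'rV[R]_n, (forall b, measurable (A b)) ->
    P (\bigcap_(b in [set: 'I_B]) (U b @^-1` A b)) =
    (\prod_(b < B) P (U b @^-1` A b))%E.

Definition grad_est {dO} {Omega : measurableType dO} (S : 'rV[R]_n -> R)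
    (B : nat) (U : 'I_B -> Omega -> 'rV[R]_n) (x : 'rV[R]_n) (delta : R)
    (w : Omega) : 'rV[R]_n :=
  B%:R^-1 *: \sum_(b < B) (sgnS S (x + delta *: U b w) *: U b w).

Definition expect_vec {dO} {Omega : measurableType dO}
    (P : probability Omega R) (X : Omega -> 'rV[R]_n) : 'rV[R]_n :=
  \row_(i < n) fine ('E_P[fun w => X w ord0 i]).

End defs.

(* Main.v *)
(** Write [g] for the gradient at [xt], [v = g / |g|], [z = <U, v>] and
    [w = L delta / (2 |g|)].  By Taylor's formula the sign of
    [S (xt + delta U)] is that of [z] outside the strip [|z| <= w], so the
    expected estimator is [E (sign z U)], a positive multiple of [v] by
    reflection symmetry, up to an error supported on the strip.

    The strip is controlled by rotation invariance alone.  For a unit vector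
    [q] orthogonal to [v], put [y = <U, q>] and let [G] be the truncation to
    [[-w, w]].  Differentiating the constant [E (y G z)] along the rotations of
    the plane of [v] and [q] gives [E (y ^ 2; |z| <= w) <= w E |z|]; summing
    over an orthonormal basis of the hyperplane orthogonal to [v] gives
    [(1 - w ^ 2) P (|z| <= w) <= (d - 1) w E |z|].  For [w d <= 2 / 3] these
    make the component along [v] at least [(3 / 4) E |z|] and the orthogonal
    one at most [w d E |z|]; for [w d > 2 / 3] the claimed bound is below [-1]. *)

Require Import Defs.
From HB Require Import structures.
From mathcomp Require Import all_boot all_order all_algebra.
From mathcomp Require Import all_classical all_reals all_analysis measurable_realfun.
From mathcomp Require Import ring lra.
Set Implicit Arguments.
Unset Strict Implicit.
Import Order.TTheory GRing.Theory Num.Theory.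
Import numFieldNormedType.Exports.
Local Open Scope classical_set_scope.
Local Open Scope ring_scope.

(** * Euclidean geometry *)

Section euclidean.
Context {R : realType} {n : nat}.
Implicit Types (a b x : 'rV[R]_n) (k : R).

Lemma dotvC a b : dotv a b = dotv b a.
Proof. by apply: eq_bigr => i _; rewrite mulrC. Qed.

Lemma dotvDl a b x : dotv (a + b) x = dotv a x + dotv b x.
Proof. by rewrite -big_split; apply: eq_bigr => i _; rewrite mxE mulrDl. Qed.

Lemma dotvZl k a x : dotv (k *: a) x = k * dotv a x.
Proof. by rewrite mulr_sumr; apply: eq_bigr => i _; rewrite mxE mulrA. Qed.

Lemma dotvBl a b x : dotv (a - b) x = dotv a x - dotv b x.
Proof. by rewrite -scaleN1r dotvDl dotvZl mulN1r. Qed.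

Lemma dotvDr x a b : dotv x (a + b) = dotv x a + dotv x b.
Proof. by rewrite dotvC dotvDl !(dotvC _ x). Qed.

Lemma dotvZr k x a : dotv x (k *: a) = k * dotv x a.
Proof. by rewrite dotvC dotvZl (dotvC a). Qed.

Lemma dotvBr x a b : dotv x (a - b) = dotv x a - dotv x b.
Proof. by rewrite dotvC dotvBl !(dotvC _ x). Qed.

Lemma dotv0l x : dotv 0 x = 0.
Proof. by rewrite -(scale0r x) dotvZl mul0r. Qed.

Lemma dotv_delta x i : dotv x (delta_mx ord0 i) = x ord0 i.
Proof.
rewrite /dotv (bigD1 i)//= big1 ?addr0; first by rewrite mxE !eqxx mulr1.
by move=> j /negbTE ji; rewrite mxE ji andbF mulr0.
Qed.

Lemma dotv_mxE a b : dotv a b = (a *m b^T) ord0 ord0.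
Proof. by rewrite mxE; apply: eq_bigr => i _; rewrite mxE. Qed.

Lemma dotv_ge0 a : 0 <= dotv a a.
Proof. by apply: sumr_ge0 => i _; rewrite -expr2 sqr_ge0. Qed.

Lemma dotv_eq0 a : dotv a a = 0 -> a = 0.
Proof.
move=> /eqP; rewrite psumr_eq0 => [/allP a0|i _]; last by rewrite -expr2 sqr_ge0.
apply/rowP => i; rewrite mxE; apply/eqP.
by have := a0 i (mem_index_enum i); rewrite mulf_eq0 orbb.
Qed.

Lemma norm2_ge0 a : 0 <= norm2 a.
Proof. exact: sqrtr_ge0. Qed.

Lemma sqr_norm2 a : norm2 a ^+ 2 = dotv a a.
Proof. by rewrite sqr_sqrtr ?dotv_ge0. Qed.

Lemma norm2_gt0 a : a != 0 -> 0 < norm2 a.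
Proof.
move=> a0; rewrite lt_neqAle norm2_ge0 andbT eq_sym; apply: contra a0 => /eqP a0.
by apply/eqP/dotv_eq0; rewrite -sqr_norm2 a0 expr0n.
Qed.

Lemma norm2Z k a : norm2 (k *: a) = `|k| * norm2 a.
Proof.
rewrite /norm2 dotvZl dotvZr mulrA -expr2 sqrtrM ?sqr_ge0//.
by rewrite sqrtr_sqr.
Qed.

Lemma dotv_eq1 a : norm2 a = 1 -> dotv a a = 1.
Proof. by move=> a1; rewrite -sqr_norm2 a1 expr1n. Qed.

Lemma unit_neq0 a : norm2 a = 1 -> a != 0.
Proof.
move=> /dotv_eq1 aa; apply/eqP => a0; move: aa; rewrite a0 dotv0l => /eqP.
by rewrite eq_sym oner_eq0.
Qed.

Lemma cauchy_schwarz a b : `|dotv a b| <= norm2 a * norm2 b.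
Proof.
rewrite -(@ler_pXn2r _ 2)// ?nnegrE ?mulr_ge0 ?norm2_ge0//.
rewrite real_normK ?num_real// exprMn !sqr_norm2.
have [/dotv_eq0 ->|b0] := eqVneq (dotv b b) 0.
  by rewrite dotvC !dotv0l expr0n/= mulr0.
have := dotv_ge0 (dotv b b *: a - dotv a b *: b).
rewrite dotvBl !dotvBr !dotvZl !dotvZr (dotvC b a) => h.
have bp : 0 < dotv b b by rewrite lt_neqAle eq_sym b0 dotv_ge0.
rewrite -(ler_pM2l bp) -subr_ge0.
by apply: le_trans h _; rewrite le_eqVlt; apply/orP; left; apply/eqP; ring.
Qed.

Lemma cauchy_schwarz_unit a b : norm2 a = 1 -> norm2 b = 1 -> `|dotv a b| <= 1.
Proof. by move=> a1 b1; have := cauchy_schwarz a b; rewrite a1 b1 mulr1. Qed.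

Lemma cos_angle_norm_le1 a b : `|cos_angle a b| <= 1.
Proof.
rewrite /cos_angle normrM normfV (ger0_norm (mulr_ge0 (norm2_ge0 a) (norm2_ge0 b))).
(* If one of the vectors vanishes, the quotient is [0] by the convention on inverses. *)
have [->|ab0] := eqVneq (norm2 a * norm2 b) 0; first by rewrite invr0 mulr0.
rewrite ler_pdivrMr ?mul1r ?cauchy_schwarz//.
by rewrite lt_neqAle eq_sym ab0 mulr_ge0 ?norm2_ge0.
Qed.

Lemma dotv_mulmx x b (Q : 'M[R]_n) : dotv (x *m Q) b = dotv x (b *m Q^T).
Proof. by rewrite !dotv_mxE trmx_mul trmxK mulmxA. Qed.

Lemma norm2_orthogonal x (Q : 'M[R]_n) :
  orthogonal_mx Q -> norm2 (x *m Q) = norm2 x.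
Proof. by move=> oQ; rewrite /norm2 dotv_mulmx -mulmxA oQ mulmx1. Qed.

(** The reflection across the hyperplane orthogonal to [a], acting on row vectors from the right.
    Invariance of the law is applied to such reflections. *)
Definition householder a : 'M[R]_n := 1%:M - (2 / dotv a a) *: (a^T *m a).

Lemma mulmx_householder x a :
  x *m householder a = x - (2 * dotv x a / dotv a a) *: a.
Proof.
rewrite /householder mulmxBr mulmx1 -scalemxAr mulmxA.
rewrite [x *m a^T]mx11_scalar -dotv_mxE mul_scalar_mx scalerA.
by rewrite mulrAC.
Qed.

Lemma orthogonal_householder a : a != 0 -> orthogonal_mx (householder a).
Proof.
move=> a0; have aa0 : dotv a a != 0 by apply: contra a0 => /eqP/dotv_eq0 ->.
rewrite /orthogonal_mx (_ : _^T = householder a); last first.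
  by rewrite /householder linearB /= linearZ /= trmx_mul trmxK trmx1.
(* Since the matrix is symmetric, orthogonality amounts to its being an involution. *)
suff HH (x : 'rV[R]_n) : x *m householder a *m householder a = x.
  by apply/row_matrixP => i; rewrite !rowE mulmxA HH mulmx1.
rewrite !mulmx_householder dotvBl dotvZl -addrA -opprD -scalerDl.
rewrite [X in X *: a](_ : _ = 0); first by rewrite scale0r subr0.
by field.
Qed.

End euclidean.

(** * Truncation to a symmetric interval *)

Section clamp.
Context {R : realType}.
Implicit Types w z y e : R.

Definition clamp w z : R := Num.max (- w) (Num.min z w).

Lemma clamp_id w z : `|z| <= w -> clamp w z = z.
Proof.
rewrite ler_norml => /andP[wz zw].
by rewrite /clamp (min_idPl zw) (max_idPr wz).
Qed.

Lemma clamp_norm_le w z : 0 <= w -> `|clamp w z| <= w.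
Proof.
move=> w0; rewrite ler_norml /clamp le_max lexx/= ge_max ge_min lexx orbT andbT.
lra.
Qed.

(** Monotonicity and the 1-Lipschitz property in one inequality: an error [e] in the argument passes
    through unamplified. *)
Lemma clamp_le w z y e : 0 <= e -> z <= y + e -> clamp w z <= clamp w y + e.
Proof.
move=> e0 zye; rewrite {1}/clamp ge_max; apply/andP; split.
  by rewrite -[leLHS]addr0 lerD// /clamp le_max lexx.
apply: (@le_trans _ _ (Num.min y w + e)); last first.
  by rewrite lerD2r /clamp le_max lexx orbT.
by rewrite addr_minl le_min !ge_min zye/= lerDl e0 orbT.
Qed.

(* The finite-difference form of d/dh [(s z + c y) clamp (c z - s y)] at h = 0,
   for the rotation with s = 2 t / (1 + t^2) and c = 1 - t s. *)
Lemma clamp_rotation_le w z y t (s := 2 * t / (1 + t ^+ 2)) (w' := w + 4 * t) :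
  0 <= w -> 0 < t <= 1 -> `|z| <= 1 -> `|y| <= 1 ->
  (`|z| <= w)%R%:R * y ^+ 2 * s <=
    `|z| * (w' * s) + t * s * (w' + 1) -
    ((s * z + (1 - t * s) * y) * clamp w' ((1 - t * s) * z - s * y)
     - y * clamp w' z).
Proof.
move=> w0 /andP[t0 t1] z1 y1.
have tt : 0 < 1 + t ^+ 2 by rewrite ltr_wpDr ?sqr_ge0.
have s0 : 0 < s by rewrite /s divr_gt0// mulr_gt0.
have s2 : s <= 2 * t.
  by rewrite /s ler_pdivrMr// ler_peMr ?mulr_ge0 ?ltW// ltrDl exprn_gt0.
have w'0 : 0 <= w' by rewrite /w'; lra.
have ts0 : 0 < t * s by rewrite mulr_gt0.
set zh := _ * z - _.
have zhE : zh = z - s * y - t * s * z by rewrite /zh; ring.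
have /andP[y2 y3] : -1 <= y <= 1 by rewrite -ler_norml.
have /andP[z2 z3] : -1 <= z <= 1 by rewrite -ler_norml.
(* The variation of the truncated factor. On the strip the truncation is the identity and yields
   [s * y ^+ 2]; off the strip monotonicity fixes the sign. Either way the error is at most
   [t * s]. *)
have key : (`|z| <= w)%R%:R * y ^+ 2 * s - t * s <= - (y * (clamp w' zh - clamp w' z)).
  have [zw|zw] := boolP (`|z| <= w).
    have tsz : `|t * s * z| <= t * s by rewrite normrM gtr0_norm// ler_piMr// ltW.
    have sy : `|s * y| <= s by rewrite normrM gtr0_norm// ler_piMr// ltW.
    have tss : t * s <= s by rewrite ler_piMl// ltW.
    (* This is why the window is widened to [w + 4 * t]: the rotation moves [z] by at most
       [s + t * s <= 2 * s <= 4 * t], so [z] and [zh] both stay inside it. *)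
    rewrite !clamp_id; last 2 first.
    - by apply: le_trans zw _; rewrite /w'; lra.
    - rewrite zhE; apply: le_trans (ler_normB _ _) _.
      by have := ler_normB z (s * y); rewrite /w'; lra.
    rewrite mul1r zhE -subr_ge0.
    have yz : `|y * z| <= 1 by rewrite normrM mulr_ile1.
    move: yz; rewrite ler_norml => /andP[yz _].
    have -> : - (y * (z - s * y - t * s * z - z)) - (y ^+ 2 * s - t * s) =
              t * s * (1 + y * z) by ring.
    by rewrite mulr_ge0// ?(ltW ts0)//; lra.
  rewrite mul0r mul0r sub0r lerN2.
  have tsz : `|t * s * z| <= t * s by rewrite normrM gtr0_norm// ler_piMr// ltW.
  move: tsz; rewrite ler_norml => /andP[tsz1 tsz2].
  have [y0|y0] := leP 0 y.
    have : clamp w' zh - clamp w' z <= t * s.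
      rewrite lerBlDl; apply: clamp_le; first exact: ltW.
      by rewrite zhE; have := mulr_ge0 (ltW s0) y0; lra.
    by nra.
  have : clamp w' z - clamp w' zh <= t * s.
    rewrite lerBlDl; apply: clamp_le; first exact: ltW.
    have : 0 < s * - y by rewrite mulr_gt0// oppr_gt0.
    by rewrite zhE mulrN; lra.
  by nra.
(* The variation of the other factor, whose increment is [s * z - t * s * y]. *)
have bd : (s * z - t * s * y) * clamp w' zh <= `|z| * (w' * s) + t * s * w'.
  apply: le_trans (ler_norm _) _; rewrite normrM.
  have h : `|s * z - t * s * y| <= s * `|z| + t * s.
    apply: le_trans (ler_normB _ _) _.
    rewrite (normrM s) (normrM (t * s)) (gtr0_norm s0) (gtr0_norm ts0).
    by rewrite lerD// ler_piMr// ltW.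
  apply: le_trans (ler_pM (normr_ge0 _) (normr_ge0 _) h (clamp_norm_le zh w'0)) _.
  by rewrite le_eqVlt; apply/orP; left; apply/eqP; ring.
(* Discrete product rule, separating the two variations bounded above. *)
have -> : (s * z + (1 - t * s) * y) * clamp w' zh - y * clamp w' z =
  (s * z - t * s * y) * clamp w' zh + y * (clamp w' zh - clamp w' z) by ring.
have -> : t * s * (w' + 1) = t * s * w' + t * s by ring.
rewrite lerBrDr; move: (lerD key bd); set X := _%:R * _ * s.
set Y := y * _; set Z := _ * clamp w' zh; clearbody X Y Z s w'; lra.
Qed.

End clamp.

(** * Expectations of essentially bounded functions *)

Section essentially_bounded.
Context {dT : measure_display} {T : measurableType dT} {R : realType}.
Variable P : probability T R.
Implicit Types (f g : T -> R) (A : set T).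

Definition full_event A := measurable A /\ P A = 1%E.

Lemma full_eventT : full_event setT.
Proof. by split; [exact: measurableT|exact: probability_setT]. Qed.

Lemma full_event_setC A : full_event A -> P (~` A) = 0%E.
Proof. by move=> [mA A1]; rewrite probability_setC// A1 subee. Qed.

Lemma full_eventI A1 A2 : full_event A1 -> full_event A2 -> full_event (A1 `&` A2).
Proof.
move=> h1 h2; have [[m1 _] [m2 _]] := (h1, h2).
have m12 : measurable (A1 `&` A2) by exact: measurableI.
split=> //.
have : P (~` (A1 `&` A2)) = 0%E.
  apply/eqP; rewrite -measure_le0 setCI.
  have -> : (0 = P (~` A1) + P (~` A2))%E by rewrite !full_event_setC// adde0.
  by apply: measureU2; exact: measurableC.
rewrite probability_setC// => /eqP; rewrite sube_eq ?fin_num_measure//.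
by rewrite add0e => /eqP.
Qed.

Import HBNNSimple.

(** The integral is a supremum over simple functions below [f]. Cutting such a function down to [A]
    keeps its integral, since the complement is null; conversely, a simple function below the
    restriction of [f] is below [f]. *)
Lemma ge0_integral_full_event A (f : T -> \bar R) : full_event A ->
  (forall x, (0 <= f x)%E) -> (\int[P]_x f x = \int[P]_(x in A) f x)%E.
Proof.
move=> hA f0; have [mA _] := hA.
rewrite ge0_integralTE// ge0_integralE//.
apply/eqP; rewrite eq_le; apply/andP; split; apply: ub_ereal_sup => _ [h /= hf <-].
  apply: ereal_sup_ubound; exists (proj_nnsfun h mA).
    move=> x /=; rewrite mindicE /patch.
    by case: ifPn => _; rewrite ?mulr1 ?mulr0.
  rewrite -!integralT_nnsfun.
  rewrite [RHS](ge0_negligible_integral (N := ~` A))//=.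
  - rewrite setTD setCK [RHS]integral_mkcond.
    apply: eq_integral => x _ /=; rewrite mindicE /patch.
    by case: ifPn => _; rewrite ?mulr1 ?mulr0.
  - exact: measurableC.
  - by apply/measurable_EFinP; exact: measurable_funP.
  - by move=> x _; rewrite lee_fin.
  - exact: full_event_setC.
apply: ereal_sup_ubound; exists h => // x.
by apply: le_trans (hf x) _; rewrite /patch; case: ifPn.
Qed.

(* No measurability of [f] is assumed: outside a full event it is arbitrary. *)
Lemma expectation_full_event A f :
  full_event A -> fine ('E_P[f]) = \int[P]_(x in A) f x.
Proof.
move=> hA; rewrite unlock /Rintegral [in LHS]integralE [in RHS]integralE.
by rewrite !(ge0_integral_full_event hA).
Qed.

(** Everything is asked on some full event only, because the estimator is uncontrolled where the
    random direction is off the sphere. *)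
Definition ess_bounded f := exists A, [/\ full_event A, measurable_fun A f &
  exists k, forall x, A x -> `|f x| <= k].

Lemma ess_boundedS A f : full_event A -> ess_bounded f ->
  exists A', [/\ A' `<=` A, full_event A', measurable_fun A' f &
  exists k, forall x, A' x -> `|f x| <= k].
Proof.
move=> hA [A0 [hA0 mf [k fk]]]; exists (A `&` A0); split.
- exact: subIsetl.
- exact: full_eventI.
- by apply: measurable_funS mf => //; case: hA0.
- by exists k => x [_ /fk].
Qed.

Lemma ess_bounded2 f g : ess_bounded f -> ess_bounded g ->
  exists A, [/\ full_event A, measurable_fun A f, measurable_fun A g &
  exists k, forall x, A x -> `|f x| <= k /\ `|g x| <= k].
Proof.
move=> [A [hA mf [k fk]]] hg; have [A' [AA hA' mg [l gl]]] := ess_boundedS hA hg.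
exists A'; split=> //; first by apply: measurable_funS mf => //; case: hA.
exists (Num.max k l) => x Ax.
by rewrite !le_max (fk _ (AA _ Ax)) (gl _ Ax) orbT.
Qed.

Lemma ess_bounded_integrable A f : full_event A -> measurable_fun A f ->
  (exists k, forall x, A x -> `|f x| <= k) -> P.-integrable A (EFin \o f).
Proof.
move=> [mA A1] mf [k fk]; apply: measurable_bounded_integrable => //.
  exact: le_lt_trans (probability_le1 P mA) (ltry _).
exists k; split; first exact: num_real.
by move=> y ky x Ax; exact: le_trans (fk _ Ax) (ltW ky).
Qed.

Lemma ess_bounded_cst k : ess_bounded (cst k).
Proof.
exists setT; split; [exact: full_eventT|exact: measurable_cst|].
by exists `|k|.
Qed.

Lemma ess_boundedD f g : ess_bounded f -> ess_bounded g ->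
  ess_bounded (fun x => f x + g x).
Proof.
move=> hf hg; have [A [hA mf mg [k fgk]]] := ess_bounded2 hf hg.
exists A; split=> //; first exact: measurable_funD.
by exists (k + k) => x /fgk[fk gk]; apply: le_trans (ler_normD _ _) (lerD fk gk).
Qed.

Lemma ess_boundedM f g : ess_bounded f -> ess_bounded g ->
  ess_bounded (fun x => f x * g x).
Proof.
move=> hf hg; have [A [hA mf mg [k fgk]]] := ess_bounded2 hf hg.
exists A; split=> //; first exact: measurable_funM.
by exists (k * k) => x /fgk[fk gk]; rewrite normrM ler_pM.
Qed.

Lemma ess_boundedZ k f : ess_bounded f -> ess_bounded (fun x => k * f x).
Proof. by move=> hf; apply: ess_boundedM => //; exact: ess_bounded_cst. Qed.

Lemma ess_bounded_sum (I : Type) (r : seq I) (F : I -> T -> R) :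
  (forall i, ess_bounded (F i)) -> ess_bounded (fun x => \sum_(i <- r) F i x).
Proof.
move=> hF; elim: r => [|i r IH].
  by under eq_fun do rewrite big_nil; exact: ess_bounded_cst.
by under eq_fun do rewrite big_cons; exact: ess_boundedD.
Qed.

Definition expect f : R := fine ('E_P[f]).

Lemma expect_cst k : expect (cst k) = k.
Proof. by rewrite /expect expectation_cst. Qed.

Lemma expectD f g : ess_bounded f -> ess_bounded g ->
  expect (fun x => f x + g x) = expect f + expect g.
Proof.
move=> hf hg; have [A [hA mf mg [k fgk]]] := ess_bounded2 hf hg.
rewrite /expect !(expectation_full_event _ hA) RintegralD//; first by case: hA.
- by apply: ess_bounded_integrable => //; exists k => x /fgk[].
- by apply: ess_bounded_integrable => //; exists k => x /fgk[].
Qed.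

Lemma expectZ k f : ess_bounded f -> expect (fun x => k * f x) = k * expect f.
Proof.
move=> [A [hA mf hk]].
rewrite /expect !(expectation_full_event _ hA) RintegralZl//; first by case: hA.
exact: ess_bounded_integrable.
Qed.

Lemma expectB f g : ess_bounded f -> ess_bounded g ->
  expect (fun x => f x - g x) = expect f - expect g.
Proof.
move=> hf hg; rewrite -mulN1r -expectZ// -expectD//; last exact: ess_boundedZ.
by congr expect; apply/funext => x; rewrite mulN1r.
Qed.

Lemma ess_boundedB f g : ess_bounded f -> ess_bounded g ->
  ess_bounded (fun x => f x - g x).
Proof.
move=> hf hg; under eq_fun do rewrite -mulN1r.
by apply: ess_boundedD => //; exact: ess_boundedZ.
Qed.

Lemma expect_sum (I : Type) (r : seq I) (F : I -> T -> R) :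
  (forall i, ess_bounded (F i)) ->
  expect (fun x => \sum_(i <- r) F i x) = \sum_(i <- r) expect (F i).
Proof.
move=> hF; elim: r => [|i r IH].
  by rewrite big_nil; under eq_fun do rewrite big_nil; exact: expect_cst.
rewrite big_cons -IH; under eq_fun do rewrite big_cons.
by rewrite expectD//; exact: ess_bounded_sum.
Qed.

Lemma le_expect A f g : full_event A -> ess_bounded f -> ess_bounded g ->
  (forall x, A x -> f x <= g x) -> expect f <= expect g.
Proof.
move=> hA hf hg fg; have [A0 [hA0 mf mg [k fgk]]] := ess_bounded2 hf hg.
have hAA := full_eventI hA hA0.
rewrite /expect !(expectation_full_event _ hAA); apply: le_Rintegral.
- by case: hAA.
- apply: ess_bounded_integrable => //; last by exists k => x [_ /fgk[]].
  by apply: measurable_funS mf => //; case: hA0.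
- apply: ess_bounded_integrable => //; last by exists k => x [_ /fgk[]].
  by apply: measurable_funS mg => //; case: hA0.
- by move=> x [/fg].
Qed.

Lemma expect_ge0 A f : full_event A -> ess_bounded f ->
  (forall x, A x -> 0 <= f x) -> 0 <= expect f.
Proof.
move=> hA hf f0; rewrite -(expect_cst 0).
by apply: le_expect hA _ hf f0; exact: ess_bounded_cst.
Qed.

End essentially_bounded.

(** * Borel sets of row vectors *)

Section measurable_row_vectors.
Context {R : realType} {n : nat}.
Local Notation V := ('rV[R]_n).

Lemma measurable_coord (i : 'I_n) : measurable_fun [set: V] (fun x : V => x ord0 i).
Proof.
move=> _ Y mY; rewrite setTI; apply: sub_sigma_algebra => /=.
rewrite -bigcup_seq/=; exists i => /=; first by rewrite mem_index_enum.
by exists Y => //; rewrite setTI.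
Qed.

(** The sigma-algebra of row vectors is generated by the coordinates, so its preimage under [f] is
    generated by the coordinates of [f]. *)
Lemma measurable_rV d1 (T1 : measurableType d1) (f : T1 -> V) :
  (forall i, measurable_fun [set: T1] (fun t => f t ord0 i)) ->
  measurable_fun [set: T1] f.
Proof.
move=> mf.
have h : g_sigma_preimage ((fun i => (fun x : V => x ord0 i) \o f) :
    'I_n -> T1 -> measurableTypeR R) `<=` measurable.
  apply: smallest_sub; first exact: sigma_algebra_measurable.
  rewrite -bigcup_seq; apply: bigcup_sub => i _.
  by move=> A [B mB <-]; exact: mf.
rewrite g_sigma_preimage_comp in h.
by move=> _ A mA; apply: h; exists A.
Qed.

Lemma measurable_dotvl (a : V) : measurable_fun [set: V] (fun x : V => dotv x a).
Proof.
apply: measurable_sum => i; apply: measurable_funM; first exact: measurable_coord.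
exact: measurable_cst.
Qed.

Lemma measurable_unit_sphere : measurable (unit_sphere : set V).
Proof.
have -> : unit_sphere = (fun x : V => dotv x x) @^-1` [set 1].
  apply/seteqP; split => x /= h; first exact: dotv_eq1.
  by rewrite /unit_sphere/= /norm2 h sqrtr1.
rewrite -[X in measurable X]setTI.
have m : measurable_fun [set: V] (fun x : V => dotv x x).
  by apply: measurable_sum => i; apply: measurable_funM; exact: measurable_coord.
by apply: m => //; exact: measurable_set1.
Qed.

Lemma measurable_mulmxr (Q : 'M[R]_n) : measurable_fun [set: V] (fun x : V => x *m Q).
Proof.
apply: measurable_rV => i; under eq_fun do rewrite mxE.
apply: measurable_sum => j; apply: measurable_funM; first exact: measurable_coord.
exact: measurable_cst.
Qed.

(** Links the topology to the product sigma-algebra: an open set is the countable union of the boxes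
    with rational centre and half-width [1 / (k + 1)] that it contains. *)
Lemma open_measurable_rV (O : set V) : open O -> measurable O.
Proof.
move=> oO.
pose box (p : 'rV[rat]_n * nat) : set V :=
  [set x | forall i, `|ratr (p.1 ord0 i) - x ord0 i| < p.2.+1%:R^-1].
have mbox p : measurable (box p).
  have -> : box p = \big[setI/setT]_(i < n)
      ((fun x : V => `|ratr (p.1 ord0 i) - x ord0 i|) @^-1` `]-oo, p.2.+1%:R^-1[).
    apply/seteqP; split => x.
      by move=> h; rewrite -bigcap_seq => i _ /=; rewrite in_itv/= h.
    by rewrite -bigcap_seq => h i; have := h i (mem_index_enum i); rewrite /= in_itv.
  apply: bigsetI_measurable => i _; rewrite -[X in measurable X]setTI.
  suff m : measurable_fun [set: V] (fun x : V => `|ratr (p.1 ord0 i) - x ord0 i|).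
    by apply: m => //; exact: measurable_itv.
  apply: measurableT_comp => //; apply: measurable_funB; first exact: measurable_cst.
  exact: measurable_coord.
have -> : O = \bigcup_p (if `[< box p `<=` O >] then box p else set0).
  apply/seteqP; split => x; last first.
    by move=> [p _]; case: asboolP => // pO /pO.
  move=> Ox; have /nbhs_ballP[e /= e0 he] := open_nbhs_nbhs (conj oO Ox).
  (* With [2 / (k + 1) < e], a box whose centre is within [1 / (k + 1)] of [x] in each coordinate
     contains [x] and lies in the ball of radius [e] around [x]. *)
  pose k := Num.truncn (2 / e).
  have ke : (k.+1%:R)^-1 *+ 2 < e.
    rewrite -[ltLHS]mulr_natl ltr_pdivrMr// mulrC -ltr_pdivrMr//.
    exact: truncnS_gt.
  have /choice[q hq] : forall i : 'I_n, exists q : rat,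
      `|ratr q - x ord0 i| < k.+1%:R^-1 :> R.
    move=> i; have [|q] := @rat_in_itvoo R (x ord0 i) (x ord0 i + k.+1%:R^-1).
      by rewrite ltrDl invr_gt0.
    rewrite in_itv/= => /andP[q1 q2]; exists q.
    by rewrite gtr0_norm ?subr_gt0// ltrBlDl.
  exists (\row_i q i, k) => //; case: asboolP => [_|]; first by move=> i; rewrite mxE.
  case => y hy; apply: he; rewrite /ball/= /mx_ball; split=> // i j.
  rewrite (ord1 i) /ball/=.
  apply: le_lt_trans ke.
  have -> : x ord0 j - y ord0 j =
    (ratr (q j) - y ord0 j) - (ratr (q j) - x ord0 j) by ring.
  apply: le_trans (ler_normB _ _) _; rewrite mulr2n lerD// ltW//.
  by have := hy j; rewrite mxE.
apply: countable_bigcupT_measurable; first exact: countableP.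
by move=> p; case: ifP => _; [exact: mbox|exact: measurable0].
Qed.

End measurable_row_vectors.

(** * Uniform directions *)

Section uniform_direction.
Context {R : realType} {n : nat} {dO : measure_display} {Omega : measurableType dO}.
Variables (P : probability Omega R) (U : Omega -> 'rV[R]_n).
Hypothesis uU : uniform_on_sphere P U.
Local Notation E := (expect P).

Let mU : measurable_fun [set: Omega] U. Proof. by case: uU. Qed.

Lemma full_event_sphere : full_event P (U @^-1` unit_sphere).
Proof.
split; last by case: uU.
by rewrite -[X in measurable X]setTI; apply: mU => //; exact: measurable_unit_sphere.
Qed.

Lemma ess_bounded_sphere (F : 'rV[R]_n -> R) (k : R) : measurable_fun setT F ->
  (forall x, norm2 x = 1 -> `|F x| <= k) -> ess_bounded P (fun o => F (U o)).
Proof.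
move=> mF Fk; exists (U @^-1` unit_sphere); split.
- exact: full_event_sphere.
- by apply: measurable_funTS; exact: measurableT_comp.
- by exists k => o Uo; exact: Fk.
Qed.

Lemma ess_bounded_dotv a : ess_bounded P (fun o => dotv (U o) a).
Proof.
apply: (@ess_bounded_sphere (fun x => dotv x a) (norm2 a)).
  exact: measurable_dotvl.
by move=> x x1; apply: le_trans (cauchy_schwarz _ _) _; rewrite x1 mul1r.
Qed.

(** Both sides are integrals of [F] over the sphere, against the laws of [U *m Q] and of [U]. These
    laws agree on measurable sets by invariance, and [Q] preserves the sphere, where [F] is bounded
    and hence integrable. *)
Lemma expect_orthogonal (F : 'rV[R]_n -> R) (k : R) Q : measurable_fun setT F ->
  (forall x, norm2 x = 1 -> `|F x| <= k) -> orthogonal_mx Q ->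
  E (fun o => F (U o *m Q)) = E (fun o => F (U o)).
Proof.
move=> mF Fk oQ.
have mUQ : measurable_fun [set: Omega] (fun o => U o *m Q).
  by apply: (measurableT_comp (measurable_mulmxr Q)).
pose m1 : {measure set 'rV[R]_n -> \bar R} :=
  measure_function_pushforward__canonical__measure_function_Measure P mU.
pose m2 : {measure set 'rV[R]_n -> \bar R} :=
  measure_function_pushforward__canonical__measure_function_Measure P mUQ.
have hS := full_event_sphere.
have preS : (fun o => U o *m Q) @^-1` unit_sphere = U @^-1` unit_sphere.
  by apply/seteqP; split => o; rewrite /unit_sphere/= norm2_orthogonal.
have ib (G : Omega -> R) : measurable_fun [set: Omega] G ->
    (forall o, norm2 (U o) = 1 -> `|G o| <= k) ->
    P.-integrable (U @^-1` unit_sphere) (EFin \o G).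
  move=> mG Gk; apply: ess_bounded_integrable => //; last by exists k.
  exact: measurable_funTS.
rewrite /expect !(expectation_full_event _ hS) /Rintegral; congr fine.
have mEF : measurable_fun [set: 'rV[R]_n] (EFin \o F) by exact/measurable_EFinP.
have mS := @measurable_unit_sphere R n.
transitivity (\int[m2]_(x in unit_sphere) (F x)%:E)%E.
  rewrite (integral_pushforward mUQ mEF)//; rewrite preS//.
  apply: (ib (fun o => F (U o *m Q))); first exact: measurableT_comp.
  by move=> o Uo; apply: Fk; rewrite norm2_orthogonal.
transitivity (\int[m1]_(x in unit_sphere) (F x)%:E)%E.
  apply: eq_measure_integral => A mA _.
  by case: uU => _ _ /(_ _ oQ _ mA).
rewrite (integral_pushforward mU mEF)//.
by apply: (ib (fun o => F (U o))); [exact: measurableT_comp|move=> o; exact: Fk].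
Qed.

End uniform_direction.

(** Passage to the limit [t -> 0] in an inequality with a linear error; it stands in for a
    differentiation under the expectation. *)
Lemma ler_addt0P {R : realFieldType} (a b c : R) : 0 <= c ->
  (forall t, 0 < t <= 1 -> a <= b + t * c) -> a <= b.
Proof.
move=> c0 h; apply/ler_addgt0Pr => e e0.
have c1 : 0 < c + 1 by lra.
(* Dividing by [c + 1] rather than [c] covers the case [c = 0]. *)
have t0 : 0 < Num.min 1 (e / (c + 1)) by rewrite lt_min ltr01 divr_gt0.
have := h _ (_ : 0 < Num.min 1 (e / (c + 1)) <= 1); rewrite t0 ge_min lexx.
move=> /(_ isT) /le_trans; apply; rewrite lerD2l.
apply: (@le_trans _ _ (e / (c + 1) * (c + 1))); last by rewrite divfK ?gt_eqF.
by apply: ler_pM => //; [exact: ltW|rewrite ge_min lexx orbT|lra].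
Qed.

(** * Mass and second moments of the strip around the equator *)

Section strip.
Context {R : realType} {n : nat} {dO : measure_display} {Omega : measurableType dO}.
Variables (P : probability Omega R) (U : Omega -> 'rV[R]_n).
Hypothesis uU : uniform_on_sphere P U.
Variable v : 'rV[R]_n.
Hypothesis v1 : norm2 v = 1.
Local Notation E := (expect P).
Local Notation z := (fun o => dotv (U o) v).
Local Notation M := (E (fun o => `|z o|)).
Local Notation strip w := (fun o => (`|z o| <= w)%R%:R).

Lemma measurable_abs_dotv : measurable_fun setT (fun x : 'rV[R]_n => `|dotv x v|).
Proof. by apply: measurableT_comp => //; exact: measurable_dotvl. Qed.

Lemma ess_bounded_abs_dotv : ess_bounded P (fun o => `|z o|).
Proof.
apply: (ess_bounded_sphere uU (F := fun x => `|dotv x v|) (k := 1)).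
  exact: measurable_abs_dotv.
by move=> x x1; rewrite normr_id cauchy_schwarz_unit.
Qed.

Lemma ess_bounded_strip (w : R) : ess_bounded P (strip w).
Proof.
apply: (ess_bounded_sphere uU (F := fun x => (`|dotv x v| <= w)%R%:R) (k := 1)).
  rewrite (_ : (fun _ => _) = fun x => if `|dotv x v| <= w then 1 else 0); last first.
    by apply/funext => x; case: ifP.
  apply: measurable_fun_ifT; [|exact: measurable_cst|exact: measurable_cst].
  apply: measurable_fun_ler; [exact: measurable_abs_dotv|exact: measurable_cst].
by move=> x _; case: (`|dotv x v| <= w); rewrite ?normr1 ?normr0.
Qed.

Lemma expect_abs_dotv_ge0 : 0 <= M.
Proof.
apply: (expect_ge0 (full_event_sphere uU) ess_bounded_abs_dotv) => o _.
exact: normr_ge0.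
Qed.

Lemma expect_abs_dotv_le1 : M <= 1.
Proof.
rewrite -[leRHS](expect_cst P); apply: (le_expect (full_event_sphere uU)).
- exact: ess_bounded_abs_dotv.
- exact: ess_bounded_cst.
- by move=> o Uo; exact: cauchy_schwarz_unit.
Qed.

Lemma measurable_dotv_clamp (w : R) (q : 'rV[R]_n) :
  measurable_fun setT (fun x : 'rV[R]_n => dotv x q * clamp w (dotv x v)).
Proof.
apply: measurable_funM; first exact: measurable_dotvl.
apply: measurable_maxr; first exact: measurable_cst.
by apply: measurable_minr; [exact: measurable_dotvl|exact: measurable_cst].
Qed.

Lemma dotv_clamp_bounded (w : R) q x : 0 <= w -> norm2 x = 1 ->
  `|dotv x q * clamp w (dotv x v)| <= norm2 q * w.
Proof.
move=> w0 x1; rewrite normrM ler_pM// ?clamp_norm_le//.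
by apply: le_trans (cauchy_schwarz _ _) _; rewrite x1 mul1r.
Qed.

(** The integrated form of [clamp_rotation_le]: [F] and its rotated version [Y] both have
    expectation zero, so only the error terms remain; divide by [s] and let [t] tend to [0]. *)
Lemma expect_strip_sqr_unit (w : R) q : 0 <= w -> norm2 q = 1 -> dotv v q = 0 ->
  E (fun o => strip w o * dotv (U o) q ^+ 2) <= w * M.
Proof.
move=> w0 q1 vq.
have vv := dotv_eq1 v1; have qq := dotv_eq1 q1; have qv : dotv q v = 0 by rewrite dotvC.
(* From [w' * M + t * (w' + 1)] with [w' = w + 4 * t], [M <= 1] and [t <= 1]: the excess over
   [w * M] is at most [t * (4 + w + 4 + 1)]. *)
apply: (@ler_addt0P _ _ _ (w + 9)); first lra.
move=> t /andP[t0 t1].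
pose s := 2 * t / (1 + t ^+ 2); pose w' := w + 4 * t.
have tt : 0 < 1 + t ^+ 2 by rewrite ltr_wpDr ?sqr_ge0.
have s0 : 0 < s by rewrite /s divr_gt0// mulr_gt0.
have w'0 : 0 <= w' by rewrite /w'; lra.
pose F x := dotv x q * clamp w' (dotv x v).
pose Y o := (s * z o + (1 - t * s) * dotv (U o) q) *
  clamp w' ((1 - t * s) * z o - s * dotv (U o) q).
have mF : measurable_fun setT F by exact: measurable_dotv_clamp.
have bF x : norm2 x = 1 -> `|F x| <= norm2 q * w' by exact: dotv_clamp_bounded.
have ebF : ess_bounded P (fun o => F (U o)) := ess_bounded_sphere uU mF bF.
(* The reflection along [q] fixes [z] and negates [F]. *)
have EF : E (fun o => F (U o)) = 0.
  have := expect_orthogonal uU mF bF (orthogonal_householder (unit_neq0 q1)).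
  rewrite (_ : (fun o => F (U o *m _)) = fun o => -1 * F (U o)); last first.
    apply/funext => o; rewrite /F mulmx_householder !dotvBl !dotvZl qq qv.
    by rewrite mulr0 subr0 [RHS]mulrA; congr (_ * _); field.
  by rewrite expectZ//; lra.
have a0 : t *: v + q != 0.
  apply/eqP => /(congr1 (fun x => dotv x q)); rewrite dotvDl dotvZl vq qq dotv0l.
  by move/eqP; rewrite mulr0 add0r oner_eq0.
have oH := orthogonal_householder a0.
(* The reflection along [t *: v + q] acts on the plane of [v] and [q] as the rotation followed by a
   sign change of the [q] coordinate, hence the minus sign. *)
have HE o : F (U o *m householder (t *: v + q)) = - Y o.
  have aa : dotv (t *: v + q) (t *: v + q) = 1 + t ^+ 2.
    by rewrite dotvDl !dotvDr !dotvZl !dotvZr vv vq qv qq; ring.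
  rewrite /F mulmx_householder aa !dotvBl !dotvZl !dotvDl !dotvDr !dotvZl !dotvZr.
  rewrite vv vq qv qq /Y -[RHS]mulNr /s; congr (_ * clamp _ _).
    by field; lra.
  by field; lra.
have ebY : ess_bounded P Y.
  have : ess_bounded P (fun o => F (U o *m householder (t *: v + q))).
    apply: (ess_bounded_sphere uU (F := fun x => F (x *m householder (t *: v + q)))
             (k := norm2 q * w')).
      by apply: measurableT_comp => //; exact: measurable_mulmxr.
    by move=> x x1; apply: bF; rewrite norm2_orthogonal.
  move=> /(ess_boundedZ (-1)).
  rewrite (_ : (fun _ => _) = Y)//.
  by apply/funext => o; rewrite HE mulN1r opprK.
have EY : E Y = 0.
  have := expect_orthogonal uU mF bF oH; rewrite EF.
  rewrite (_ : (fun _ => _) = fun o => -1 * Y o); last first.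
    by apply/funext => o; rewrite HE mulN1r.
  by rewrite expectZ//; lra.
have eb1 : ess_bounded P (fun o => strip w o * dotv (U o) q ^+ 2).
  apply: ess_boundedM; first exact: ess_bounded_strip.
  by apply: ess_boundedM; exact: ess_bounded_dotv.
have ebz := ess_bounded_abs_dotv.
have : E (fun o => s * (strip w o * dotv (U o) q ^+ 2)) <=
    E (fun o => (w' * s * `|z o| + t * s * (w' + 1)) - (Y o - F (U o))).
  apply: (le_expect (full_event_sphere uU)).
  - exact: ess_boundedZ.
  - apply: ess_boundedB; last exact: ess_boundedB.
    by apply: ess_boundedD; [exact: ess_boundedZ|exact: ess_bounded_cst].
  - move=> o Uo; rewrite mulrC (mulrC (w' * s)).
    apply: clamp_rotation_le => //; [by rewrite t0| |]; exact: cauchy_schwarz_unit.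
have ebc : ess_bounded P (cst (t * s * (w' + 1))) by exact: ess_bounded_cst.
have ebzs : ess_bounded P (fun o => w' * s * `|z o|) by exact: ess_boundedZ.
rewrite expectZ// expectB//; last 2 first.
- exact: ess_boundedD.
- exact: ess_boundedB.
rewrite expectD// expect_cst expectZ// expectB// EF EY subrr subr0.
rewrite (_ : _ + _ = s * (w' * M + t * (w' + 1))); last by ring.
rewrite ler_pM2l// => /le_trans; apply.
have := expect_abs_dotv_le1; have := expect_abs_dotv_ge0; rewrite /w'.
by move: M => m; nra.
Qed.

(** By homogeneity from the unit case. The vector [0] is included because a projected basis vector
    may vanish. *)
Lemma expect_strip_sqr (w : R) q : 0 <= w -> dotv v q = 0 ->
  E (fun o => strip w o * dotv (U o) q ^+ 2) <= norm2 q ^+ 2 * (w * M).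
Proof.
move=> w0 vq; have [->|q0] := eqVneq q 0.
  rewrite (_ : (fun _ => _) = cst 0); last first.
    by apply/funext => o; rewrite (dotvC _ 0) dotv0l expr0n mulr0.
  by rewrite expect_cst mulr_ge0 ?sqr_ge0// mulr_ge0 ?expect_abs_dotv_ge0.
have N0 := norm2_gt0 q0.
have := @expect_strip_sqr_unit w ((norm2 q)^-1 *: q) w0.
rewrite norm2Z gtr0_norm ?invr_gt0// mulVf ?gt_eqF// dotvZr vq mulr0.
move=> /(_ erefl erefl); rewrite -(ler_pM2l (exprn_gt0 2 N0)).
rewrite -[leLHS]expectZ; last first.
  apply: ess_boundedM; first exact: ess_bounded_strip.
  by apply: ess_boundedM; exact: ess_bounded_dotv.
rewrite (_ : (fun _ => _) = (fun o => strip w o * dotv (U o) q ^+ 2))//.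
apply/funext => o; rewrite dotvZr; field.
exact: lt0r_neq0.
Qed.

(* Summing the previous bound over the projections of the canonical basis onto
   the hyperplane orthogonal to [v]. *)
Lemma expect_strip (w : R) : 0 <= w ->
  (1 - w ^+ 2) * E (strip w) <= (n%:R - 1) * (w * M).
Proof.
move=> w0; pose q (i : 'I_n) : 'rV[R]_n := delta_mx ord0 i - v ord0 i *: v.
have vv := dotv_eq1 v1.
have vq i : dotv v (q i) = 0.
  by rewrite /q dotvBr dotvZr vv dotv_delta mulr1 subrr.
have nq i : norm2 (q i) ^+ 2 = 1 - v ord0 i * v ord0 i.
  rewrite sqr_norm2 {1}/q dotvBl dotvZl vq mulr0 subr0.
  by rewrite dotvC dotv_delta /q !mxE !eqxx.
have eb i : ess_bounded P (fun o => strip w o * dotv (U o) (q i) ^+ 2).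
  apply: ess_boundedM; first exact: ess_bounded_strip.
  by apply: ess_boundedM; exact: ess_bounded_dotv.
have : E (fun o => \sum_i strip w o * dotv (U o) (q i) ^+ 2) <= (n%:R - 1) * (w * M).
  rewrite expect_sum//.
  apply: (@le_trans _ _ (\sum_i norm2 (q i) ^+ 2 * (w * M))).
    by apply: ler_sum => i _; exact: expect_strip_sqr.
  rewrite -mulr_suml; apply: ler_wpM2r; first by rewrite mulr_ge0 ?expect_abs_dotv_ge0.
  (* The squared lengths sum to [n - |v|^2 = n - 1]. *)
  under eq_bigr do rewrite nq.
  by rewrite sumrB sumr_const card_ord -/(dotv v v) vv lexx.
apply: le_trans.
rewrite -expectZ; last exact: ess_bounded_strip.
apply: (le_expect (full_event_sphere uU)).
- by apply: ess_boundedZ; exact: ess_bounded_strip.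
- exact: ess_bounded_sum.
- move=> o Uo; rewrite -mulr_sumr mulrC.
  (* Parseval: the projections of the basis recover the squared length of the part of [U o]
     orthogonal to [v], which is at least [1 - w ^+ 2] on the strip. *)
  have -> : \sum_i dotv (U o) (q i) ^+ 2 = 1 - z o ^+ 2.
    rewrite (eq_bigr (fun i => U o ord0 i * U o ord0 i
      - 2 * z o * (U o ord0 i * v ord0 i) + z o ^+ 2 * (v ord0 i * v ord0 i))); last first.
      by move=> i _; rewrite /q dotvBr dotvZr dotv_delta; ring.
    rewrite big_split sumrB -!mulr_sumr -/(dotv (U o) (U o)) -/(dotv (U o) v).
    by rewrite -/(dotv v v) vv (dotv_eq1 Uo) /=; ring.
  have [zw|_] := boolP (`|z o| <= w); last by rewrite !mul0r.
  rewrite !mul1r lerD2l lerN2 -(real_normK (num_real (z o))).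
  by rewrite ler_pXn2r// nnegrE.
Qed.

(** If [M] were [0], [expect_strip] at [w = 1 / 2] would make the strip null, whereas Markov's
    inequality would give it full mass. *)
Lemma expect_abs_dotv_gt0 : 0 < M.
Proof.
rewrite lt_neqAle expect_abs_dotv_ge0 andbT; apply/eqP => M0.
have h := @expect_strip 2^-1 (ltW _); rewrite -M0 !mulr0 in h.
have h1 : 2^-1 * (1 - E (strip 2^-1)) <= M.
  have eb1 := ess_bounded_cst P 1; have ebs := ess_bounded_strip 2^-1.
  have -> : 2^-1 * (1 - E (strip 2^-1)) = E (fun o => 2^-1 * (1 - strip 2^-1 o)).
    by rewrite expectZ ?expectB ?expect_cst//; exact: ess_boundedB.
  apply: (le_expect (full_event_sphere uU)).
  - by apply/ess_boundedZ/ess_boundedB.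
  - exact: ess_bounded_abs_dotv.
  - move=> o _; have [_|] := boolP (`|z o| <= _); first by rewrite subrr mulr0.
    by rewrite -ltNge subr0 mulr1 => /ltW.
have : (1 - 2^-1 ^+ 2) * E (strip 2^-1) <= 0 by apply: h; rewrite invr_gt0.
by rewrite -M0 in h1; lra.
Qed.

End strip.

(** For [n >= 2] the claim follows from [(n - 2) * (9 * n - 14) >= 0], after bounding
    [w ^ 2 * n ^ 2] by [4 / 9]. The constant [9 / 32] gives equality at [n = 2], [w = 1 / 3]. *)
Lemma pred_le_strip_constant {R : realType} (n : nat) (w : R) :
  (0 < n)%N -> w ^+ 2 * n%:R ^+ 2 <= 4 / 9 ->
  n%:R - 1 <= 9 / 32 * n%:R ^+ 2 * (1 - w ^+ 2) :> R.
Proof.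
move=> n0 wn; have [n1|n1] := eqVneq n 1.
  by move: wn; rewrite n1 subrr expr1n !mulr1; lra.
have n2 : 2 <= n%:R :> R by rewrite (ler_nat _ 2) ltn_neqAle eq_sym n1.
nra.
Qed.

(** * Correlations of [U] with a sign that is reliable only off the strip *)

Section noisy_sign.
Context {R : realType} {n : nat} {dO : measure_display} {Omega : measurableType dO}.
Variables (P : probability Omega R) (U : Omega -> 'rV[R]_n).
Hypothesis uU : uniform_on_sphere P U.
Variable v : 'rV[R]_n.
Hypothesis v1 : norm2 v = 1.
Local Notation E := (expect P).
Local Notation z := (fun o => dotv (U o) v).
Local Notation M := (E (fun o => `|z o|)).
Local Notation strip w := (fun o => (`|z o| <= w)%R%:R).

Variables (phi : Omega -> R) (w : R).
Hypothesis ebphi : ess_bounded P phi.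
Hypothesis w0 : 0 <= w.
Hypothesis wn : w * n%:R <= 2 / 3.
Hypothesis phi1 : forall o, `|phi o| <= 1.
Hypothesis phi_pos : forall o, norm2 (U o) = 1 -> w < z o -> phi o = 1.
Hypothesis phi_neg : forall o, norm2 (U o) = 1 -> z o < - w -> phi o = -1.

Let n0 : (0 < n)%N.
Proof.
rewrite lt0n; apply/eqP => n0; have := dotv_eq1 v1; rewrite /dotv big1.
  by move/eqP; rewrite eq_sym oner_eq0.
by move=> i _; have := ltn_ord i; rewrite {2}n0.
Qed.

Let wn2 : w ^+ 2 * n%:R ^+ 2 <= 4 / 9.
Proof.
rewrite -exprMn (_ : 4 / 9 = (2 / 3) ^+ 2); last by field.
by rewrite ler_pXn2r ?nnegrE ?mulr_ge0 ?ler0n.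
Qed.

Let w1 : w ^+ 2 < 1.
Proof.
have n1 : 1 <= n%:R :> R by rewrite (ler_nat _ 1).
have : w <= 2 / 3 by apply: le_trans wn; rewrite ler_peMr.
by move=> w23; apply: (@le_lt_trans _ _ ((2 / 3) ^+ 2)); [rewrite ler_pXn2r ?nnegrE|lra].
Qed.

(** Clears the positive factor [1 - w ^+ 2] of [expect_strip], at the price of the constant
    [9 / 32]. *)
Let strip_le : E (strip w) <= 9 / 32 * n%:R ^+ 2 * (w * M).
Proof.
have M0 := expect_abs_dotv_ge0 uU v1.
rewrite -(@ler_pM2l _ (1 - w ^+ 2)) ?subr_gt0//.
apply: le_trans (expect_strip uU v1 w0) _.
have := pred_le_strip_constant n0 wn2.
have : 0 <= w * M by rewrite mulr_ge0.
move: (w * M) => m m0 h; rewrite mulrA (mulrC (1 - _)).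
exact: ler_wpM2r.
Qed.

(** Off the strip [phi * z = |z|], and on it [phi * z >= |z| - 2 * w]. By [strip_le] the loss is at
    most [9 / 16 * (w * n) ^ 2 * M], that is, at most [M / 4]. *)
Lemma expect_sign_dotv_ge : 3 / 4 * M <= E (fun o => phi o * z o).
Proof.
have M0 := expect_abs_dotv_ge0 uU v1.
have ebz := ess_bounded_abs_dotv uU v1; have ebs := ess_bounded_strip uU v w.
have : E (fun o => `|z o| - (2 * w) * strip w o) <= E (fun o => phi o * z o).
  apply: (le_expect (full_event_sphere uU)).
  - by apply: ess_boundedB => //; exact: ess_boundedZ.
  - by apply: ess_boundedM => //; exact: ess_bounded_dotv.
  - move=> o Uo; have [zw|] := boolP (`|z o| <= w).
      have : - `|z o| <= phi o * z o.
        have : `|phi o * z o| <= `|z o| by rewrite normrM ler_piMl.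
        by rewrite ler_norml => /andP[].
      by rewrite mulr1; move: zw; move: (`|_|) (_ * _) => a b; lra.
    rewrite -ltNge ltr_normr mulr0 subr0 => /orP[wz|wz].
      by rewrite phi_pos// mul1r ger0_norm// ltW// (le_lt_trans w0 wz).
    rewrite phi_neg//; last by rewrite ltrNr.
    by rewrite mulN1r ler0_norm// -oppr_ge0 ltW// (le_lt_trans w0 wz).
rewrite expectB//; last exact: ess_boundedZ.
rewrite expectZ//; apply: le_trans.
have := ler_wpM2l w0 strip_le; move: wn2 M0; move: M (E (strip w)) => m s.
rewrite [w * (9 / _ * _ * _)](_ : _ = 9 / 32 * (w ^+ 2 * n%:R ^+ 2) * m); last by ring.
by move: (w ^+ 2 * n%:R ^+ 2) => k; nra.
Qed.

(** Replacing [phi] by an odd function of [z] gives expectation zero, by reflection along [v]. The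
    difference lives on the strip, where [|y|] is traded for [y ^ 2] and a constant, with
    [y = <U, q>]. *)
Lemma expect_sign_dotv_orthogonal_le q : dotv v q = 0 ->
  E (fun o => phi o * dotv (U o) q) <= w * n%:R * M * norm2 q.
Proof.
move=> vq; have M0 := expect_abs_dotv_ge0 uU v1.
have [->|q0] := eqVneq q 0.
  rewrite (_ : (fun _ => _) = cst 0); last first.
    by apply/funext => o; rewrite (dotvC _ 0) dotv0l mulr0.
  by rewrite expect_cst mulr_ge0 ?norm2_ge0// mulr_ge0// mulr_ge0.
have N0 := norm2_gt0 q0; set N := norm2 q in N0 *.
have nR0 : 0 < n%:R :> R by rewrite ltr0n.
(* The sign off the strip and [0] on it; [h] is odd. *)
pose h (x : R) : R := (w < x)%R%:R - (x < - w)%R%:R.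
have mh : measurable_fun setT h.
  rewrite (_ : h = fun x => (if w < x then 1 else 0) - (if x < - w then 1 else 0)); last first.
    by apply/funext => x; rewrite /h; do 2 case: ifP.
  apply: measurable_funB.
    apply: measurable_fun_ifT; [|exact: measurable_cst|exact: measurable_cst].
    by apply: measurable_fun_ltr; [exact: measurable_cst|exact: measurable_id].
  apply: measurable_fun_ifT; [|exact: measurable_cst|exact: measurable_cst].
  by apply: measurable_fun_ltr; [exact: measurable_id|exact: measurable_cst].
pose F x := h (dotv x v) * dotv x q.
have mF : measurable_fun setT F.
  apply: measurable_funM; last exact: measurable_dotvl.
  by apply: measurableT_comp => //; exact: measurable_dotvl.
have bF x : norm2 x = 1 -> `|F x| <= 2 * N.
  move=> x1; rewrite normrM ler_pM//.
    rewrite /h; apply: le_trans (ler_normB _ _) _; rewrite !normr_nat.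
    by case: (_ < _)%R; case: (_ < _)%R; rewrite ?addr0 ?add0r// (ler_nat _ _ 2).
  by apply: le_trans (cauchy_schwarz _ _) _; rewrite x1 mul1r.
have ebF : ess_bounded P (fun o => F (U o)) := ess_bounded_sphere uU mF bF.
have EF : E (fun o => F (U o)) = 0.
  have vv := dotv_eq1 v1.
  have := expect_orthogonal uU mF bF (orthogonal_householder (unit_neq0 v1)).
  rewrite (_ : (fun o => F (U o *m _)) = fun o => -1 * F (U o)); last first.
    apply/funext => o; rewrite /F mulmx_householder !dotvBl !dotvZl vv vq.
    rewrite mulr0 subr0 [RHS]mulrA; congr (_ * _).
    rewrite [X in h X](_ : _ = - z o); last by field.
    rewrite /h ltrNr ltrN2; ring.
  by rewrite expectZ//; lra.
have ebs := ess_bounded_strip uU v w.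
have eby := ess_bounded_dotv uU q.
have ebsy : ess_bounded P (fun o => strip w o * dotv (U o) q ^+ 2).
  by apply: ess_boundedM => //; exact: ess_boundedM.
(* Weights with [k * l = 1 / 4], scaled so that both strip bounds become multiples of
   [w * n * M * N]. *)
pose k := n%:R / (2 * N); pose l := N / (2 * n%:R).
have : E (fun o => phi o * dotv (U o) q) <=
    E (fun o => F (U o) + (k * (strip w o * dotv (U o) q ^+ 2) + l * strip w o)).
  have eb2 : ess_bounded P (fun o => k * (strip w o * dotv (U o) q ^+ 2) + l * strip w o).
    by apply: ess_boundedD; exact: ess_boundedZ.
  apply: (le_expect (full_event_sphere uU)).
  - exact: ess_boundedM.
  - exact: ess_boundedD.
  - move=> o Uo; rewrite /F /h; have [zw|] := boolP (`|z o| <= w).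
      move: (zw); rewrite ler_norml => /andP[zw1 zw2].
      rewrite (le_gtF zw2) (le_gtF zw1) subrr mul0r add0r mul1r mulr1.
      apply: (@le_trans _ _ `|dotv (U o) q|).
        by apply: le_trans (ler_norm _) _; rewrite normrM ler_piMl.
      rewrite -(real_normK (num_real (dotv _ q))).
      (* AM-GM: k l = 1/4 *)
      have k0 : 0 < k by rewrite /k divr_gt0 ?mulr_gt0.
      rewrite -subr_ge0 -(pmulr_rge0 _ k0).
      have kl : k * l = 1 / 4 by rewrite /k /l; field; rewrite !gt_eqF.
      have -> : k * (k * `|dotv (U o) q| ^+ 2 + l - `|dotv (U o) q|) =
        (k * `|dotv (U o) q| - 1 / 2) ^+ 2 + (k * l - 1 / 4) by field.
      by rewrite kl subrr addr0 sqr_ge0.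
    rewrite -ltNge ltr_normr mul0r !mulr0 !addr0 => /orP[wz|wz].
      by rewrite phi_pos// wz le_gtF ?subr0// (le_trans _ (ltW wz))// ge0_cp.
    have wz' : z o < - w by rewrite ltrNr.
    by rewrite phi_neg// wz' le_gtF ?sub0r// (le_trans (ltW wz'))// ge0_cp.
rewrite expectD ?EF ?add0r//; last by apply: ess_boundedD; exact: ess_boundedZ.
rewrite expectD ?expectZ//; [|exact: ess_boundedZ|exact: ess_boundedZ].
move=> /le_trans; apply.
have k0 : 0 <= k by rewrite /k ltW// divr_gt0 ?mulr_gt0.
have l0 : 0 <= l by rewrite /l ltW// divr_gt0 ?mulr_gt0.
have := lerD (ler_wpM2l k0 (expect_strip_sqr uU v1 w0 vq)) (ler_wpM2l l0 strip_le).
move=> /le_trans; apply; rewrite -/N.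
(* The two contributions are [1 / 2] and [9 / 64], with sum [41 / 64 < 1]. *)
have -> : k * (N ^+ 2 * (w * M)) + l * (9 / 32 * n%:R ^+ 2 * (w * M)) =
  (w * n%:R * M * N) * (41 / 64) by rewrite /k /l; field; rewrite !gt_eqF.
by rewrite ler_piMr//; [rewrite !mulr_ge0// ltW|lra].
Qed.

End noisy_sign.

(** * The sign of [S] near a boundary point *)

Section taylor.
Context {R : realType} {n : nat}.
Variables (S : 'rV[R]_n -> R) (xt : 'rV[R]_n) (V : set 'rV[R]_n) (L delta : R).
Hypothesis d0 : 0 < delta.
Hypothesis ball_V : [set y | norm2 (y - xt) <= delta] `<=` V.
Hypothesis dS : forall y, V y -> differentiable S y.
Hypothesis lipS : forall y z, V y -> V z ->
  norm2 (grad S y - grad S z) <= L * norm2 (y - z).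

Lemma diff_grad y p : 'd S y p = dotv (grad S y) p.
Proof.
rewrite {1}(row_sum_delta p) linear_sum /dotv; apply: eq_bigr => i _.
by rewrite linearZ /= mxE mulrC.
Qed.

(** The difference quotient along the line is the directional difference quotient of [S] at
    [xt + s *: p]. *)
Lemma is_derive_line p (s : R) : differentiable S (xt + s *: p) ->
  is_derive s 1 (fun r : R => S (xt + r *: p)) (dotv (grad S (xt + s *: p)) p).
Proof.
move=> dSs.
have E : (fun h : R => h^-1 *: (((fun r : R => S (xt + r *: p)) \o shift s) (h *: 1)
    - S (xt + s *: p))) =
  (fun h : R => h^-1 *: ((S \o shift (xt + s *: p)) (h *: p) - S (xt + s *: p))).
  apply/funext => h /=; congr (_ *: (S _ - _)).
  by rewrite scalerDl addrCA [h *: 1]mulr1.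
apply: DeriveDef.
  by rewrite /derivable E; exact: diff_derivable.
by rewrite /derive E -/(derive _ _ _) deriveE// diff_grad.
Qed.

Lemma ball_line_V p s : norm2 p <= delta -> 0 <= s <= 1 -> V (xt + s *: p).
Proof.
move=> pd /andP[s0 s1]; apply: ball_V => /=.
by rewrite addrC addKr norm2Z ger0_norm// (le_trans _ pd)// ler_piMl// norm2_ge0.
Qed.

(** Taking [e] to be [1] or [-1] gives both halves of the quadratic Taylor estimate. The mean value
    theorem is applied to the signed remainder minus its quadratic bound, whose derivative is
    nonpositive by Cauchy-Schwarz and the Lipschitz hypothesis. *)
Lemma taylor_one_sided (e : R) p : `|e| = 1 -> norm2 p <= delta ->
  e * (S (xt + p) - S xt - dotv (grad S xt) p) <= L / 2 * norm2 p ^+ 2.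
Proof.
move=> e1 pd; set g := grad S xt.
pose c := L / 2 * norm2 p ^+ 2.
pose f (s : R) : R := e * (S (xt + s *: p) - dotv g p * s) - c * s ^+ 2.
pose df (s : R) : R :=
  e * (dotv (grad S (xt + s *: p)) p - dotv g p) - c * (2 * s).
have der (s : R) : 0 <= s <= 1 -> is_derive s 1 f (df s).
  move=> s01.
  have h1 := is_derive_line (dS (ball_line_V pd s01)).
  have h2 := is_deriveZ (dotv g p) (is_derive_id s (1 : R)).
  have h3 := is_deriveZ c (is_deriveX 2 (is_derive_id s (1 : R))).
  have h := is_deriveB (is_deriveZ e (is_deriveB h1 h2)) h3.
  have -> : df s = e *: (dotv (grad S (xt + s *: p)) p - dotv g p *: 1) -
      c *: ((2%:R * s ^+ 1) *: 1).
    by rewrite /df /GRing.scale/= !mulr1.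
  exact: h.
have [||c' c'01] := @MVT_segment R f df 0 1 ler01.
- by move=> s; rewrite in_itv/= => /andP[s0 s1]; apply: der; rewrite !ltW.
- apply: derivable_within_continuous => s; rewrite in_itv/= => s01.
  by have [] := der _ s01.
rewrite in_itv/= in c'01.
have : df c' <= 0.
  rewrite /df subr_le0.
  have -> : c * (2 * c') = L * norm2 (c' *: p) * norm2 p.
    by case/andP: c'01 => c'0 _; rewrite /c norm2Z ger0_norm//; field.
  apply: le_trans (ler_norm _) _; rewrite normrM e1 mul1r -dotvBl.
  apply: le_trans (cauchy_schwarz _ _) _; apply: ler_wpM2r; first exact: norm2_ge0.
  have Vxt : V xt.
    by have := @ball_line_V p 0 pd; rewrite lexx ler01 scale0r addr0; apply.
  have := lipS (ball_line_V pd c'01) Vxt.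
  by have -> : xt + c' *: p - xt = c' *: p by rewrite addrC addKr.
move=> dfle; rewrite subr0 mulr1 => ff.
have : f 1 - f 0 <= 0 by rewrite ff.
rewrite /f scale1r scale0r !addr0 expr1n expr0n/= mulr1 !mulr0 mulr1 !subr0 -/c.
by move: (S _) (S _) (dotv _ _) => A B C; rewrite !mulrBr; lra.
Qed.

(** The sign of [L] is forced by two points of [V] at distance [delta], which exist in positive
    dimension. *)
Lemma lipschitz_constant_ge0 : (0 < n)%N -> 0 <= L.
Proof.
move=> n0; pose p : 'rV[R]_n := delta *: delta_mx ord0 (Ordinal n0).
have np : norm2 p = delta.
  by rewrite norm2Z gtr0_norm// /norm2 dotv_delta mxE !eqxx sqrtr1 mulr1.
have Vp : V (xt + 1 *: p) by apply: ball_line_V; rewrite ?np// ler01 lexx.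
have V0 : V (xt + 0 *: p) by apply: ball_line_V; rewrite ?np// ler01 lexx.
have := le_trans (norm2_ge0 _) (lipS Vp V0).
have -> : xt + 1 *: p - (xt + 0 *: p) = p.
  by rewrite scale0r scale1r addr0 addrC addKr.
by rewrite np pmulr_lge0.
Qed.

(** The threshold is where the linear term [delta * |g| * z] overtakes the Taylor remainder bound
    [L * delta ^ 2 / 2]. *)
Lemma sgnS_pos (u : 'rV[R]_n) (g := grad S xt) : S xt = 0 -> g != 0 ->
  norm2 u = 1 -> L * delta / (2 * norm2 g) < dotv u ((norm2 g)^-1 *: g) ->
  sgnS S (xt + delta *: u) = 1.
Proof.
move=> S0 g0 u1; have N0 := norm2_gt0 g0.
have np : norm2 (delta *: u) = delta by rewrite norm2Z u1 gtr0_norm// mulr1.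
have := @taylor_one_sided (-1) (delta *: u).
rewrite normrN1 np lexx S0 subr0 mulN1r -/g => /(_ erefl erefl).
rewrite dotvZr !dotvZr (dotvC u) ltr_pdivlMl// => h1 h2.
rewrite /sgnS ifT//.
have h3 : L * delta / 2 < dotv g u.
  apply: le_lt_trans h2; rewrite le_eqVlt; apply/orP; left; apply/eqP.
  by field; rewrite gt_eqF.
move: h1 h3; move: (S _) (dotv _ _) => s k h1 h3.
have : delta * (L * delta / 2) < delta * k by rewrite ltr_pM2l.
by nra.
Qed.

Lemma sgnS_neg (u : 'rV[R]_n) (g := grad S xt) : S xt = 0 -> g != 0 ->
  norm2 u = 1 -> dotv u ((norm2 g)^-1 *: g) < - (L * delta / (2 * norm2 g)) ->
  sgnS S (xt + delta *: u) = -1.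
Proof.
move=> S0 g0 u1; have N0 := norm2_gt0 g0.
have np : norm2 (delta *: u) = delta by rewrite norm2Z u1 gtr0_norm// mulr1.
have := @taylor_one_sided 1 (delta *: u).
rewrite normr1 np lexx S0 subr0 mul1r -/g => /(_ erefl erefl).
rewrite dotvZr !dotvZr (dotvC u) ltr_pdivrMl// => h1 h2.
rewrite /sgnS ifF//; apply/negbTE; rewrite -leNgt.
have h3 : dotv g u < - (L * delta / 2).
  apply: lt_le_trans h2 _; rewrite le_eqVlt; apply/orP; left; apply/eqP.
  by field; rewrite gt_eqF.
move: h1 h3; move: (S _) (dotv _ _) => s k h1 h3.
have : delta * k < delta * - (L * delta / 2) by rewrite ltr_pM2l.
by nra.
Qed.

Lemma sgnS_norm_le1 x : `|sgnS S x| <= 1.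
Proof. by rewrite /sgnS; case: ifP; rewrite ?normrN1 ?normr1. Qed.

(* On the sphere [xt + delta *: U] stays in [V], where [S] is continuous, so
   positivity of [S] there is an open condition; elsewhere [S] is arbitrary. *)
Lemma ess_bounded_sgnS {dO : measure_display} {Omega : measurableType dO}
    (P : probability Omega R) (U : Omega -> 'rV[R]_n) :
  open V -> uniform_on_sphere P U ->
  ess_bounded P (fun o => sgnS S (xt + delta *: U o)).
Proof.
move=> oV uU; have hS := full_event_sphere uU; have [mS _] := hS.
have mU : measurable_fun [set: Omega] U by case: uU.
exists (U @^-1` unit_sphere); split=> //; last first.
  by exists 1 => o _; exact: sgnS_norm_le1.
pose O : set 'rV[R]_n := (fun x => xt + delta *: x) @^-1` [set y | V y /\ 0 < S y].
have oO : open O.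
  apply: open_comp.
    move=> x _; apply: (@continuousD _ _ _ (cst xt) (fun x => delta *: x)).
      exact: cst_continuous.
    exact: scaler_continuous.
  rewrite openE => y [Vy Sy]; apply: filterI; first exact: open_nbhs_nbhs.
  have /differentiable_continuous cS := dS Vy.
  exact: (cvgr_gt (S y) cS).
apply: measurable_fun_if => //.
- apply: (measurable_fun_bool true).
  rewrite (_ : _ `&` _ = U @^-1` unit_sphere `&` U @^-1` O).
    apply: measurableI => //; rewrite -[X in measurable X]setTI; apply: mU => //.
    exact: open_measurable_rV.
  apply/seteqP; split => o [Uo]; last by case.
  move=> /= So; split=> //; split=> //; apply: ball_V => /=.
  by rewrite addrC addKr norm2Z Uo mulr1 gtr0_norm.
Qed.

End taylor.

(** * The cosine bound *)

Section cosine.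
Context {R : realType} {n : nat}.

Lemma dotv_suml (I : Type) (r : seq I) (F : I -> 'rV[R]_n) a :
  dotv (\sum_(i <- r) F i) a = \sum_(i <- r) dotv (F i) a.
Proof.
by apply: (big_morph (fun x => dotv x a)) => [x y|]; rewrite ?dotvDl ?dotv0l.
Qed.

Lemma dotv_orthogonal_decomposition (m v : 'rV[R]_n) : dotv v v = 1 ->
  dotv m m = dotv m v ^+ 2 + norm2 (m - dotv m v *: v) ^+ 2.
Proof.
move=> vv.
by rewrite sqr_norm2 dotvBl !dotvBr !dotvZl !dotvZr vv (dotvC v); ring.
Qed.

(** The cosine is [a / |m|]. Pythagoras gives [|m| <= a * (1 + t ^ 2 / 2)], and
    [(1 - t ^ 2 / 2) * (1 + t ^ 2 / 2) <= 1]. *)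
Lemma cos_angle_ge (m g : 'rV[R]_n) (t : R) (v := (norm2 g)^-1 *: g)
    (a := dotv m v) :
  g != 0 -> 0 < a -> 0 <= t -> norm2 (m - a *: v) <= t * a ->
  1 - t ^+ 2 / 2 <= cos_angle m g.
Proof.
move=> g0 a0 t0 qt; have N0 := norm2_gt0 g0.
have vv : dotv v v = 1.
  by rewrite /v dotvZl dotvZr -sqr_norm2; field; rewrite gt_eqF.
have m2 := dotv_orthogonal_decomposition m vv; rewrite -/a in m2.
have mle : norm2 m <= a * (1 + t ^+ 2 / 2).
  have r0 : 0 <= a * (1 + t ^+ 2 / 2).
    by rewrite mulr_ge0 ?ltW// ltr_wpDr// divr_ge0 ?sqr_ge0.
  rewrite -(@ler_pXn2r _ 2)// ?nnegrE ?norm2_ge0// sqr_norm2 m2.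
  have q2 : norm2 (m - a *: v) ^+ 2 <= (t * a) ^+ 2.
    by rewrite ler_pXn2r// ?nnegrE ?norm2_ge0// mulr_ge0// ltW.
  apply: le_trans (lerD (lexx _) q2) _; rewrite -subr_ge0.
  have -> : (a * (1 + t ^+ 2 / 2)) ^+ 2 - (a ^+ 2 + (t * a) ^+ 2) =
    (a * t ^+ 2 / 2) ^+ 2 by field.
  exact: sqr_ge0.
have m0 : 0 < norm2 m.
  rewrite lt_neqAle norm2_ge0 andbT eq_sym; apply/eqP => m0.
  have : 0 < dotv m m by rewrite m2 ltr_wpDr ?sqr_ge0// exprn_gt0.
  by rewrite -sqr_norm2 m0 expr0n ltxx.
have -> : cos_angle m g = a / norm2 m.
  by rewrite /cos_angle /a /v dotvZr; field; rewrite !gt_eqF.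
(* The bound on [norm2 m] can be multiplied through only when the factor is nonnegative; otherwise
   the left side is already nonpositive. *)
rewrite ler_pdivlMr//; have [h|h] := leP 0 (1 - t ^+ 2 / 2); last first.
  by apply: le_trans (ltW a0); rewrite mulr_le0_ge0 ?ltW.
apply: le_trans (ler_wpM2l h mle) _; rewrite -subr_ge0.
have -> : a - (1 - t ^+ 2 / 2) * (a * (1 + t ^+ 2 / 2)) = a * (t ^+ 2 / 2) ^+ 2 by ring.
by rewrite mulr_ge0 ?sqr_ge0 ?ltW.
Qed.

End cosine.

(** * The expected gradient estimate and its angle with the gradient *)

Section gradient_estimate.
Context {R : realType} {n : nat} {dO : measure_display} {Omega : measurableType dO}.
Variables (S : 'rV[R]_n -> R) (xt : 'rV[R]_n) (L delta : R).
Variables (P : probability Omega R) (B : nat) (u : 'I_B -> Omega -> 'rV[R]_n).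
Hypothesis S0 : S xt = 0.
Hypothesis g0 : grad S xt != 0.
Hypothesis d0 : 0 < delta.
Hypothesis regS : exists V : set 'rV[R]_n,
      [/\ open V,
          [set y | norm2 (y - xt) <= delta] `<=` V,
          (forall y, V y -> differentiable S y) &
          (forall y z, V y -> V z ->
             norm2 (grad S y - grad S z) <= L * norm2 (y - z))].
Hypothesis B0 : (0 < B)%N.
Hypothesis uu : forall b, uniform_on_sphere P (u b).
Local Notation g := (grad S xt).
Local Notation phi b := (fun o => sgnS S (xt + delta *: u b o)).

Lemma dotv_expect_vec (X : Omega -> 'rV[R]_n) a :
  (forall i, ess_bounded P (fun o => X o ord0 i)) ->
  dotv (expect_vec P X) a = expect P (fun o => dotv (X o) a).
Proof.
move=> hX; rewrite /dotv (eq_bigr (fun i => expect P (fun o => X o ord0 i * a ord0 i))).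
  by rewrite expect_sum// => i; apply: ess_boundedM => //; exact: ess_bounded_cst.
move=> i _; rewrite mxE mulrC -[fine _]/(expect P _) -expectZ//.
by congr expect; apply/funext => o; rewrite mulrC.
Qed.

(** Linearity of the expectation reduces the estimator to one random direction at a time. *)
Lemma dotv_expect_grad_est a :
  dotv (expect_vec P (grad_est S u xt delta)) a =
  B%:R^-1 * \sum_(b < B) expect P (fun o => phi b o * dotv (u b o) a).
Proof.
have [V [oV bV dS lS]] := regS.
have eb b x : ess_bounded P (fun o => phi b o * dotv (u b o) x).
  apply: ess_boundedM; last exact: ess_bounded_dotv.
  exact: (ess_bounded_sgnS d0 bV dS oV).
have GE x o : dotv (grad_est S u xt delta o) x =
    B%:R^-1 * \sum_(b < B) phi b o * dotv (u b o) x.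
  rewrite /grad_est dotvZl dotv_suml; congr (_ * _).
  by apply: eq_bigr => b _; rewrite dotvZl.
rewrite dotv_expect_vec => [|i].
  under eq_fun do rewrite GE.
  by rewrite expectZ ?expect_sum//; exact: ess_bounded_sum.
(* A coordinate is the pairing with a basis vector, so [GE] applies again. *)
under eq_fun do rewrite -dotv_delta GE.
by apply/ess_boundedZ/ess_bounded_sum.
Qed.

Lemma cos_angle_expect_grad_est_ge :
  1 - (9 * L ^+ 2 * delta ^+ 2 * n%:R ^+ 2) / (8 * norm2 g ^+ 2) <=
  cos_angle (expect_vec P (grad_est S u xt delta)) g.
Proof.
have [V [oV bV dS lS]] := regS.
have N0 := norm2_gt0 g0.
have n0 : (0 < n)%N.
  rewrite lt0n; apply/eqP => n0; move/eqP: g0; apply; apply/rowP => i.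
  by have := ltn_ord i; rewrite {2}n0.
have L0 := lipschitz_constant_ge0 d0 bV lS n0.
pose w := L * delta / (2 * norm2 g).
have w0 : 0 <= w by rewrite /w divr_ge0// mulr_ge0// ltW.
have -> : 9 * L ^+ 2 * delta ^+ 2 * n%:R ^+ 2 / (8 * norm2 g ^+ 2) =
  9 / 2 * (w * n%:R) ^+ 2 by rewrite /w; field; rewrite gt_eqF.
have wn0 : 0 <= w * n%:R by rewrite mulr_ge0.
(* Beyond [2 / 3] the subtracted term [9 / 2 * (w * n) ^ 2] exceeds [2], so the bound falls below
   [-1] and is trivial. *)
have [wn|wn] := leP (w * n%:R) (2 / 3); last first.
  have := cos_angle_norm_le1 (expect_vec P (grad_est S u xt delta)) g.
  rewrite ler_norml => /andP[h _]; apply: le_trans h.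
  by move: (w * n%:R) wn => r wn; nra.
pose v := (norm2 g)^-1 *: g.
have v1 : norm2 v = 1 by rewrite norm2Z gtr0_norm ?invr_gt0// mulVf ?gt_eqF.
pose m := expect_vec P (grad_est S u xt delta).
pose M b := expect P (fun o => `|dotv (u b o) v|).
(* The common scale against which both components of [m] are measured. *)
pose Mbar := B%:R^-1 * \sum_b M b.
have B1 : 0 < B%:R^-1 :> R by rewrite invr_gt0 ltr0n.
have M0 : 0 < Mbar.
  rewrite mulr_gt0//; case: B u uu B0 @M {Mbar m B1} => // B' u' uu' _ M.
  rewrite big_ord_recl ltr_wpDr//; last exact: expect_abs_dotv_gt0.
  by apply: sumr_ge0 => b _; exact: expect_abs_dotv_ge0.
have ebphi b := ess_bounded_sgnS d0 bV dS oV (uu b).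
have phi1 b o : `|phi b o| <= 1 := sgnS_norm_le1 S _.
have php b o (h : norm2 (u b o) = 1) := sgnS_pos d0 bV dS lS S0 g0 h.
have phn b o (h : norm2 (u b o) = 1) := sgnS_neg d0 bV dS lS S0 g0 h.
have mv : 3 / 4 * Mbar <= dotv m v.
  rewrite dotv_expect_grad_est mulrCA ler_pM2l// mulr_sumr; apply: ler_sum => b _.
  exact: (expect_sign_dotv_ge (uu b) v1 (ebphi b) w0 wn (phi1 b) (php b) (phn b)).
have mq q : dotv v q = 0 -> dotv m q <= w * n%:R * Mbar * norm2 q.
  move=> vq; rewrite dotv_expect_grad_est.
  rewrite (_ : w * n%:R * Mbar * norm2 q =
    B%:R^-1 * \sum_b (w * n%:R * M b * norm2 q)); last first.
    by rewrite -mulr_suml -mulr_sumr /Mbar; ring.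
  rewrite ler_pM2l//; apply: ler_sum => b _.
  exact: (expect_sign_dotv_orthogonal_le
    (uu b) v1 (ebphi b) w0 wn (phi1 b) (php b) (phn b)).
have a0 : 0 < dotv m v by apply: lt_le_trans mv; rewrite mulr_gt0// divr_gt0.
pose q := m - dotv m v *: v.
have vq : dotv v q = 0.
  by rewrite /q dotvBr dotvZr (dotv_eq1 v1) mulr1 (dotvC v) subrr.
have qle : norm2 q <= w * n%:R * Mbar.
  have [->|q0] := eqVneq q 0.
    by rewrite -(scale0r 0) norm2Z normr0 mul0r mulr_ge0// ltW.
  (* Test [mq] on [q] itself: the pairing of [m] with [q] is [|q|^2], and one factor [|q|]
     cancels. *)
  rewrite -(ler_pM2r (norm2_gt0 q0)); apply: le_trans (mq _ vq).
  by rewrite -expr2 sqr_norm2 {1}/q dotvBl dotvZl vq mulr0 subr0.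
(* The ratio of the component bounds [w * n * Mbar] and [3 / 4 * Mbar]. The resulting loss
   [8 / 9 * (w * n) ^ 2] is within the allowed [9 / 2 * (w * n) ^ 2]. *)
have := @cos_angle_ge _ _ m g (4 / 3 * (w * n%:R)) g0 a0.
rewrite mulr_ge0// => /(_ isT) h.
apply: le_trans (h _); last first.
  apply: le_trans qle _; rewrite -/v.
  by move: mv wn0; move: (w * n%:R) (dotv m v) => r a; nra.
by move: (w * n%:R) => r; have := sqr_ge0 r; rewrite exprMn; lra.
Qed.

End gradient_estimate.

Theorem theorem2 (R : realType) (d : nat) (S : 'rV[R]_d -> R)
  (xt : 'rV[R]_d) (L delta : R)
  (dO : measure_display) (Omega : measurableType dO) (P : probability Omega R)
  (B : nat) (u : 'I_B -> Omega -> 'rV[R]_d) :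
  S xt = 0 ->
  grad S xt != 0 ->
  0 < delta < 1 ->
  (exists V : set 'rV[R]_d,
      [/\ open V,
          [set y | norm2 (y - xt) <= delta] `<=` V,
          (forall y, V y -> differentiable S y) &
          (forall y z, V y -> V z ->
             norm2 (grad S y - grad S z) <= L * norm2 (y - z))]) ->
  (0 < B)%N ->
  (forall b, uniform_on_sphere P (u b)) ->
  mutually_independent P u ->
  cos_angle (expect_vec P (grad_est S u xt delta)) (grad S xt)
    >= 1 - (9 * L ^+ 2 * delta ^+ 2 * d%:R ^+ 2) / (8 * norm2 (grad S xt) ^+ 2)
  /\
  (fun e => cos_angle (expect_vec P (grad_est S u xt e)) (grad S xt))
    @ 0^'+ --> (1 : R).
Proof.
move=> S0 g0 /andP[d0 _] [V [oV bV dS lS]] B0 uu _.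
(* The neighbourhood given for [delta] serves every smaller radius, so the estimate holds uniformly
   as the radius shrinks. *)
have bound (e : R) : 0 < e <= delta ->
    1 - (9 * L ^+ 2 * e ^+ 2 * d%:R ^+ 2) / (8 * norm2 (grad S xt) ^+ 2) <=
    cos_angle (expect_vec P (grad_est S u xt e)) (grad S xt).
  move=> /andP[e0 ed]; apply: cos_angle_expect_grad_est_ge => //.
  by exists V; split=> // y /= ye; apply: bV; exact: le_trans ye ed.
split; first by apply: bound; rewrite d0 lexx.
pose C := 9 * L ^+ 2 * d%:R ^+ 2 / (8 * norm2 (grad S xt) ^+ 2).
(* The cosine is squeezed between the bound, written as [1 - C * e ^+ 2], and [1]. *)
apply: (@squeeze_cvgr _ _ _ _ (fun e : R => 1 - C * e ^+ 2) (cst 1)).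
- near=> e; apply/andP; split.
    have -> : C * e ^+ 2 =
        9 * L ^+ 2 * e ^+ 2 * d%:R ^+ 2 / (8 * norm2 (grad S xt) ^+ 2).
      by rewrite /C; ring.
    by apply: bound; apply/andP; split; near: e;
      [exact: nbhs_right_gt|exact: nbhs_right_le].
  by have := cos_angle_norm_le1 (expect_vec P (grad_est S u xt e)) (grad S xt);
    rewrite ler_norml => /andP[].
- rewrite -[X in _ --> X](_ : 1 - C * 0 ^+ 2 = 1); last by rewrite expr0n mulr0 subr0.
  apply: cvg_at_right_filter; apply: cvgB; first exact: cvg_cst.
  by apply: cvgMr; apply: exprn_continuous.
- exact: cvg_cst.
Unshelve. all: by end_near.
Qed.
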